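(* The horizontal and vertical sequences of the aromatic bicomplex are exact. That is, for every order $N\ge 1$: (i) for all $n\ge 1$, $p\ge 0$, $\operatorname{Im}(d_H|_{\Omega_{n+1,p}^N})=\operatorname{Ker}(d_H|_{\Omega_{n,p}^N})$; (ii) for all $n\ge 0$, $p\ge 0$, $\operatorname{Im}(d_V|_{\Omega_{n,p}^N})=\operatorname{Ker}(d_V|_{\Omega_{n,p+1}^N})$, and $d_V$ is injective on $\Omega_{n,0}^N$.
   Context: Aromatic forests. Let $V$ be a finite nonempty set of nodes and $E\subset V\times V$ a set of edges; an edge $(v,w)$ goes from $v$ to $w$ and then $v$ is a predecessor of $w$; $\Pi(v)$ is the set of predecessors of $v$. Each node is the source of at most one edge; nodes with no outgoing edge are called roots. $V$ is split into vertices $V^\bullet$ and covertices $V^\circ$. The covertices are numbered $1,\dots,p$, the roots are numbered $1,\dots,n$, the vertices are not numbered. Such graphs, up to isomorphism preserving the vertex/covertex type and the numberings of covertices and roots, are called aromatic forests; $\mathcal F_{n,p}$ is the set of aromatic forests with $n$ roots and $p$ covertices. The order $|\gamma|$ is the number of nodes; $\mathcal F_{n,p}^N$ is the subset of forests of order $N$. Aromatic forms. The symmetric groups $S_n^\bullet$ and $S_p^\circ$ act on $\mathcal F_{n,p}$ by permuting the numbers of the roots, respectively covertices. Set $\wedge^\bullet\gamma=\frac1{n!}\sum_{\sigma\in S_n^\bullet}\varepsilon(\sigma)\sigma\gamma$, $\wedge^\circ\gamma=\frac1{p!}\sum_{\sigma\in S_p^\circ}\varepsilon(\sigma)\sigma\gamma$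 ($\varepsilon$ the signature), $\wedge=\wedge^\bullet\wedge^\circ=\wedge^\circ\wedge^\bullet$, extended linearly. $\Omega_{n,p}=\wedge\operatorname{Span}_{\mathbb R}(\mathcal F_{n,p})$ and $\Omega_{n,p}^N=\wedge\operatorname{Span}_{\mathbb R}(\mathcal F_{n,p}^N)$. Derivatives. For a root $r$ and a node $u$ (possibly $u=r$), $D^{r\to u}\gamma$ is $\gamma$ with the edge $(r,u)$ added, and $D^r\gamma=\sum_{u\in V}D^{r\to u}\gamma$. For $v\in V^\bullet$, $\gamma_{v\to c_k}$ is $\gamma$ with $v$ replaced by a covertex numbered $k$. For $\gamma\in\mathcal F_{n,p}$ with root number $n$ denoted $r_n$ ($n\ge1$), $d_H\gamma=D^{r_n}\gamma$ and $d_V\gamma=\wedge\sum_{v\in V^\bullet}\gamma_{v\to c_{p+1}}$. By linearity $d_H:\Omega_{n,p}\to\Omega_{n-1,p}$ ($n\ge1$) and $d_V:\Omega_{n,p}\to\Omega_{n,p+1}$; both preserve the order $N$. The aromatic bicomplex has horizontal rows $\cdots\to\Omega_{2,p}\to\Omega_{1,p}\to\Omega_{0,p}$ (maps $d_H$) and vertical columns $0\to\Omega_{n,0}\to\Omega_{n,1}\to\cdots$ (maps $d_V$). *)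

(* Defs.v *)
From HB Require Import structures.
From mathcomp Require Import all_boot all_order all_fingroup all_algebra.
From mathcomp Require Import reals.

Set Implicit Arguments.
Unset Strict Implicit.
Unset Printing Implicit Defensive.

Import GRing.Theory.
Local Open Scope ring_scope.
Local Open Scope quotient_scope.

(* Finite graphs on the node set 'I_N, before taking isomorphism classes.     *)
(* Numbers run from 0: root number i of the literature is [root g (i - 1)],   *)
(* and likewise for covertices.                                               *)
Section LabelledForests.
Variables N n p : nat.
Implicit Types (E : {set 'I_N * 'I_N}) (r : {ffun 'I_n -> 'I_N})
  (c : {ffun 'I_p -> 'I_N}).

Definition functional E : bool :=
  [forall u, forall v, forall w,
     ((u, v) \in E) ==> ((u, w) \in E) ==> (v == w)].

Definition is_root E (u : 'I_N) : bool := [forall v, (u, v) \notin E].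

Definition numbers_roots E r : bool :=
  injectiveb r && [forall u, (u \in codom r) == is_root E u].

Definition is_forest
    (x : {set 'I_N * 'I_N} * {ffun 'I_n -> 'I_N} * {ffun 'I_p -> 'I_N}) : bool :=
  [&& functional x.1.1, numbers_roots x.1.1 x.1.2 & injectiveb x.2].

Record lforest := LForest {
  lforest_val : {set 'I_N * 'I_N} * {ffun 'I_n -> 'I_N} * {ffun 'I_p -> 'I_N};
  lforest_valP : is_forest lforest_val }.

HB.instance Definition _ := [isSub for lforest_val].
HB.instance Definition _ := [Finite of lforest by <:].

Definition edges (g : lforest) : {set 'I_N * 'I_N} := (lforest_val g).1.1.
Definition root (g : lforest) : {ffun 'I_n -> 'I_N} := (lforest_val g).1.2.
Definition cov (g : lforest) : {ffun 'I_p -> 'I_N} := (lforest_val g).2.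

(* The covertices are exactly the numbered nodes of [cov g]. *)
Definition is_vertex (g : lforest) (v : 'I_N) : bool := v \notin codom (cov g).

(* Compatibility with [cov] makes s preserve the vertex/covertex type too. *)
Definition iso_by (s : 'S_N) (g h : lforest) : bool :=
  [&& [forall u, forall v, ((s u, s v) \in edges h) == ((u, v) \in edges g)],
      [forall i, root h i == s (root g i)] &
      [forall k, cov h k == s (cov g k)]].

Definition iso (g h : lforest) : bool := [exists s : 'S_N, iso_by s g h].

Lemma iso_byP (s : 'S_N) g h :
  reflect [/\ forall u v, ((s u, s v) \in edges h) = ((u, v) \in edges g),
              forall i, root h i = s (root g i) &
              forall k, cov h k = s (cov g k)]
          (iso_by s g h).
Proof.
apply: (iffP and3P) => [[/forallP sE /forallP sr /forallP sc]|[sE sr sc]].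
  split=> [u v|i|k]; [|exact/eqP|exact/eqP].
  by have /forallP/(_ v)/eqP := sE u.
split; [|by apply/forallP=> i; apply/eqP..].
by apply/forallP=> u; apply/forallP=> v; apply/eqP.
Qed.

Lemma iso_refl : reflexive iso.
Proof.
move=> g; apply/existsP; exists 1%g.
by apply/iso_byP; split=> *; rewrite !perm1.
Qed.

Lemma iso_by_sym (s : 'S_N) g h : iso_by s g h -> iso_by s^-1%g h g.
Proof.
move=> /iso_byP[sE sr sc]; apply/iso_byP.
by split=> [u v|i|k]; [rewrite -sE !permKV|rewrite sr permK|rewrite sc permK].
Qed.

Lemma iso_sym : symmetric iso.
Proof.
by move=> g h; apply/existsP/existsP=> -[s /iso_by_sym]; exists s^-1%g.
Qed.

Lemma iso_trans : transitive iso.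
Proof.
move=> h g k /existsP[s /iso_byP[sE sr sc]] /existsP[t /iso_byP[tE tr tc]].
apply/existsP; exists (s * t)%g.
by apply/iso_byP; split=> *; rewrite !permM ?tE ?sE ?tr ?sr ?tc ?sc.
Qed.

Canonical iso_equiv := EquivRel iso iso_refl iso_sym iso_trans.

Definition forest := {eq_quot iso}.
HB.instance Definition _ := EqQuotient.on forest.
HB.instance Definition _ := Countable.copy forest (can_type (@reprK _ forest)).
HB.instance Definition _ : isFinite forest := CanIsFinite (@reprK _ forest).

Lemma pi_iso g h : iso g h -> \pi_forest g = \pi_forest h.
Proof. by move=> gh; apply/eqmodP. Qed.

End LabelledForests.

Arguments iso_byP {N n p s g h}.

Lemma lforestP N n p (g : lforest N n p) :
  [/\ functional (edges g), numbers_roots (edges g) (root g)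
    & injectiveb (cov g)].
Proof. exact/and3P/lforest_valP. Qed.

Lemma mem_codom_comp (n N : nat) (r : {ffun 'I_n -> 'I_N}) (s : 'S_n) u :
  (u \in codom [ffun i => r (s i)]) = (u \in codom r).
Proof.
apply/codomP/codomP=> -[i ->]; first by exists (s i); rewrite ffunE.
by exists ((s^-1)%g i); rewrite ffunE permKV.
Qed.

Lemma root_no_edge N n p (g : lforest N n p) i v : (root g i, v) \notin edges g.
Proof.
have [_ /andP[_ /forallP/(_ (root g i)) rE] _] := lforestP g; move: rE.
by rewrite codom_f => /eqP/esym; rewrite /is_root => /forallP.
Qed.

Section Operations.
Variables N n p : nat.

(* Under s, the root numbered i becomes the root numbered [s i]. *)
Lemma act_root_subproof (s : 'S_n) (g : lforest N n p) :
  is_forest (edges g, [ffun i => root g (s^-1%g i)], cov g).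
Proof.
have [fE /andP[/injectiveP r_inj /forallP rE] c_inj] := lforestP g.
apply/and3P; split=> //=; apply/andP; split.
  by apply/injectiveP=> i j; rewrite !ffunE => /r_inj/perm_inj.
by apply/forallP=> u; rewrite mem_codom_comp.
Qed.
Definition act_root s g : lforest N n p := LForest (act_root_subproof s g).

Lemma act_cov_subproof (s : 'S_p) (g : lforest N n p) :
  is_forest (edges g, root g, [ffun k => cov g (s^-1%g k)]).
Proof.
have [fE rE /injectiveP c_inj] := lforestP g.
apply/and3P; split=> //=.
by apply/injectiveP=> i j; rewrite !ffunE => /c_inj/perm_inj.
Qed.
Definition act_cov s g : lforest N n p := LForest (act_cov_subproof s g).

(* The edge goes from the root with the last number to u, and the remaining   *)
(* roots keep their numbers.                                                  *)
Lemma add_edge_subproof (g : lforest N n.+1 p) (u : 'I_N) :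
  is_forest ((root g ord_max, u) |: edges g,
             [ffun i : 'I_n => root g (lift ord_max i)], cov g).
Proof.
have [/forallP fE /andP[/injectiveP r_inj /forallP rE] c_inj] := lforestP g.
apply/and3P; split=> //=.
  apply/forallP=> v; apply/forallP=> w; apply/forallP=> x.
  apply/implyP=> vw; apply/implyP=> vx.
  move: vw vx; rewrite !inE !xpair_eqE.
  have [->|_] /= := eqVneq v (root g ord_max).
    by rewrite !(negPf (root_no_edge _ _ _)) !orbF => /eqP-> /eqP->.
  by move=> vw vx; have /forallP/(_ w)/forallP/(_ x) := fE v; rewrite vw vx.
apply/andP; split.
  by apply/injectiveP=> i j; rewrite !ffunE => /r_inj/lift_inj.
apply/forallP=> v; rewrite /is_root; apply/eqP; apply/codomP/forallP=> [[i ->] w|vE].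
  rewrite ffunE !inE negb_or xpair_eqE (inj_eq r_inj).
  by rewrite eq_sym (negPf (neq_lift _ _)) root_no_edge.
have /codomP[j vj] : v \in codom (root g).
  rewrite (eqP (rE v)) /is_root; apply/forallP=> w.
  by have := vE w; rewrite !inE negb_or => /andP[].
case: (unliftP ord_max j) vj => [i ->|->] vj; first by exists i; rewrite ffunE.
by have := vE u; rewrite vj !inE eqxx.
Qed.
Definition add_edge g u : lforest N n p := LForest (add_edge_subproof g u).

(* The vertex v becomes the covertex with the new last number. *)
Lemma to_cov_subproof (g : lforest N n p) (v : {v | is_vertex g v}) :
  is_forest (edges g, root g,
             [ffun k : 'I_p.+1 => oapp (cov g) (val v) (unlift ord_max k)]).
Proof.
have [fE rE /injectiveP c_inj] := lforestP g.
apply/and3P; split=> //=; apply/injectiveP=> i j; rewrite !ffunE.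
case: v => v /= v_vtx.
case: unliftP => [i' ->|->]; case: unliftP => [j' ->|->] //=.
- by move/c_inj->.
- by move=> vE; rewrite /is_vertex -vE codom_f in v_vtx.
by move=> vE; rewrite /is_vertex vE codom_f in v_vtx.
Qed.
Definition to_cov g v : lforest N n p.+1 := LForest (@to_cov_subproof g v).

End Operations.

(* The order N is fixed, so there are finitely many forests and functions     *)
(* forest -> R are the formal linear combinations of forests.                 *)
Definition Span (R : realType) (N n p : nat) := {ffun forest N n p -> R^o}.
HB.instance Definition _ R N n p := Vector.on (Span R N n p).

(* Locked: unification would otherwise try to compute \pi.                     *)
HB.lock Definition basis (R : realType) (N n p : nat) (g : lforest N n p)
  : Span R N n p := [ffun h => (h == \pi_(forest N n p) g)%:R].

Section Bicomplex.
Variables (R : realType) (N : nat).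

Local Notation basis := (@basis R N _ _).

(* Linear extension of a map given on labelled forests; the maps below take   *)
(* isomorphic labelled forests to the same value, so that evaluating them at  *)
(* the representative [repr h] of a class h involves no choice.               *)
Definition extend n p m q (f : lforest N n p -> Span R N m q)
    (x : Span R N n p) : Span R N m q :=
  \sum_(h : forest N n p) x h *: f (generic_quotient.repr h).

Lemma extend_is_linear n p m q (f : lforest N n p -> Span R N m q) :
  linear (extend f).
Proof.
move=> a x y; rewrite /extend scaler_sumr -big_split /=.
by apply: eq_bigr => h _; rewrite !ffunE scalerDl scalerA.
Qed.
HB.instance Definition _ n p m q f :=
  GRing.isLinear.Build R (Span R N n p) (Span R N m q) _ (extend f)
    (extend_is_linear f).

Definition wedge_root_lf n p (g : lforest N n p) : Span R N n p :=
  n`!%:R^-1 *: \sum_(s : 'S_n) (-1) ^+ s *: basis (act_root s g).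

Definition wedge_cov_lf n p (g : lforest N n p) : Span R N n p :=
  p`!%:R^-1 *: \sum_(s : 'S_p) (-1) ^+ s *: basis (act_cov s g).

Definition dH_lf n p (g : lforest N n.+1 p) : Span R N n p :=
  \sum_(u : 'I_N) basis (add_edge g u).

Definition sum_to_cov_lf n p (g : lforest N n p) : Span R N n p.+1 :=
  \sum_(v : {v | is_vertex g v}) basis (to_cov v).

Lemma basis_iso n p (s : 'S_N) (g h : lforest N n p) : iso_by s g h -> basis g = basis h.
Proof.
by move=> gh; rewrite basis.unlock (pi_iso (g := g) (h := h)) //; apply/existsP; exists s.
Qed.

Lemma wedge_root_lf_iso n p (g h : lforest N n p) :
  iso g h -> wedge_root_lf g = wedge_root_lf h.
Proof.
case/existsP=> s /iso_byP[sE sr sc]; congr (_ *: _).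
apply: eq_bigr => t _; congr (_ *: _); apply: (@basis_iso _ _ s).
by apply/iso_byP; split=> [u v|i|k]; [exact: sE|rewrite !ffunE; exact: sr|exact: sc].
Qed.

Lemma wedge_cov_lf_iso n p (g h : lforest N n p) :
  iso g h -> wedge_cov_lf g = wedge_cov_lf h.
Proof.
case/existsP=> s /iso_byP[sE sr sc]; congr (_ *: _).
apply: eq_bigr => t _; congr (_ *: _); apply: (@basis_iso _ _ s).
by apply/iso_byP; split=> [u v|i|k]; [exact: sE|exact: sr|rewrite !ffunE; exact: sc].
Qed.

Lemma dH_lf_iso n p (g h : lforest N n.+1 p) : iso g h -> dH_lf g = dH_lf h.
Proof.
case/existsP=> s /iso_byP[sE sr sc].
rewrite /dH_lf [RHS](reindex_inj (@perm_inj _ s)) /=.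
apply: eq_bigr => u _; apply: (@basis_iso _ _ s).
apply/iso_byP; split=> [v w|i|k]; [|by rewrite !ffunE; exact: sr|exact: sc].
by rewrite !inE !xpair_eqE sr !(inj_eq perm_inj) sE.
Qed.

Lemma sum_to_cov_lf_iso n p (g h : lforest N n p) :
  iso g h -> sum_to_cov_lf g = sum_to_cov_lf h.
Proof.
case/existsP=> s /iso_byP[sE sr sc].
have svtx v : is_vertex h (s v) = is_vertex g v.
  congr (~~ _); apply/codomP/codomP=> -[k].
    by rewrite sc => /perm_inj->; exists k.
  by move->; exists k; rewrite sc.
have vtx (v : {v | is_vertex g v}) : is_vertex h (s (val v)).
  by rewrite svtx (valP v).
have vtxV (v : {v | is_vertex h v}) : is_vertex g ((s^-1)%g (val v)).
  by rewrite -svtx permKV (valP v).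
rewrite /sum_to_cov_lf [RHS](reindex (fun v => exist (is_vertex h) _ (vtx v))) /=.
  apply: eq_bigr => v _; apply: (@basis_iso _ _ s).
  apply/iso_byP; split=> [u w|i|k]; [exact: sE|exact: sr|].
  by rewrite !ffunE; case: unliftP => [k' _|_] //=.
exists (fun v => exist (is_vertex g) _ (vtxV v)) => v _; apply: val_inj => /=.
  by rewrite permK.
by rewrite permKV.
Qed.

Definition wedge n p : 'Hom(Span R N n p, Span R N n p) :=
  (linfun (extend (@wedge_root_lf n p)) \o linfun (extend (@wedge_cov_lf n p)))%VF.

Definition Omega n p : {vspace Span R N n p} := limg (wedge n p).

Definition dH n p : 'Hom(Span R N n.+1 p, Span R N n p) :=
  linfun (extend (@dH_lf n p)).

Definition dV n p : 'Hom(Span R N n p, Span R N n p.+1) :=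
  (wedge n p.+1 \o linfun (extend (@sum_to_cov_lf n p)))%VF.

End Bicomplex.

(* Main.v *)
Require Import Defs.
From HB Require Import structures.
From mathcomp Require Import all_boot all_order all_fingroup all_algebra.
From mathcomp Require Import reals.

(** Both directions of the bicomplex are instances of one algebraic pattern.
    Let [V m] be spaces carrying an action of the symmetric group on m letters,
    linked by equivariant maps [up : V m -> V m.+1] and [down : V m.+1 -> V m],
    where [up] creates a letter in the last position and [down] consumes the
    last letter. Suppose that applying [down] and then [up] to x gives k x plus
    the result of applying [up], swapping the new letter with the previous last
    one, and applying [down]. Then every alternating x in [V m] with m > 0
    satisfies, with [alt] the antisymmetrization,

      (m + 1) down (alt (up x)) + m alt (up (down x)) = k m x + down (up x),

    which is lemma [homotopy]. It rests on the fact that the antisymmetrization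
    of a vector that already alternates in all letters but the last is, up to a
    factor, that vector minus its images under the transpositions moving the
    last letter ([alternate_swaps]).

    Vertically, the letters are the covertices, [up] turns a vertex into a new
    covertex, so that [alt] after [up] is d_V, and [down] forgets the last
    covertex number; here k = 1. Since [down (up x)] is x times the number of
    vertices, the right-hand side of the identity is N x. Thus forgetting a
    number is a contracting homotopy of the columns up to nonzero factors
    ([forget_dV]).

    Horizontally, the letters are the roots, [down] is d_H, which grafts the
    last root on all the nodes, and [up] cuts the edge out of a node, which
    becomes the last root; here k = N. The right-hand side is now a Laplacian
    N m + d_H cut. On formal sums of labelled graphs, cutting is the transpose
    of grafting ([sum_add_edge_preimage]), so the second term of the Laplacian
    is positive semidefinite there and the Laplacian is injective
    ([laplacian_inj]). It maps the kernel of d_H in the alternating forms to the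
    image of d_H, which is contained in that kernel because d_H d_H = 0; by
    dimension, the kernel and the image are equal. *)

Set Implicit Arguments.
Unset Strict Implicit.
Unset Printing Implicit Defensive.

Import Order.TTheory GRing.Theory Num.Theory.

(** * Antisymmetrization and the homotopy identity *)

Section Ladder.
Local Open Scope ring_scope.

(** The embedding of S_m in S_(m+1) as the stabilizer of the last letter. *)
Definition last_lift m (s : 'S_m) : 'S_m.+1 := lift_perm ord_max ord_max s.

(** With [tperm ord_max ord_max = 1], these transpositions represent the cosets
    of the stabilizer of the last letter. *)
Definition swap_last m (j : 'I_m) : 'S_m.+1 := tperm (lift ord_max j) ord_max.

Lemma last_liftE m (s : 'S_m) i : last_lift s (lift ord_max i) = lift ord_max (s i).
Proof. exact: lift_perm_lift. Qed.

Lemma last_lift_max m (s : 'S_m) : last_lift s ord_max = ord_max.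
Proof. exact: lift_perm_id. Qed.

Lemma last_liftV m (s : 'S_m) : (last_lift s)^-1%g = last_lift s^-1%g.
Proof. exact: lift_permV. Qed.

Lemma odd_last_lift m (s : 'S_m) : last_lift s = s :> bool.
Proof. by rewrite odd_lift_perm addbb. Qed.

Lemma last_lift_inj m : injective (@last_lift m).
Proof.
move=> s t /permP st; apply/permP=> i; apply: (@lift_inj _ ord_max).
by rewrite -!last_liftE st.
Qed.

Lemma odd_swap_last m (j : 'I_m) : swap_last j = true :> bool.
Proof. by rewrite odd_tperm eq_sym neq_lift. Qed.

Lemma swap_last_conj m (j : 'I_m) :
  swap_last (lift ord_max j) =
  (last_lift (swap_last j) * swap_last ord_max * last_lift (swap_last j))%g.
Proof.
have tK : (last_lift (swap_last j))^-1%g = last_lift (swap_last j).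
  by rewrite last_liftV tpermV.
rewrite -{1}tK -mulgA -/(conjg _ _) tpermJ last_liftE last_lift_max.
by rewrite /swap_last tpermR.
Qed.

(** The coset of a permutation is read off the image of the last letter, and the
    two sides have the same cardinality, so that injectivity is enough. *)
Lemma coset_bij m : bijective
  (fun js : 'I_m.+1 * 'S_m => last_lift js.2 * tperm js.1 ord_max)%g.
Proof.
apply: inj_card_bij => [[j s] [k t] /= e|]; last first.
  by rewrite card_prod card_ord !card_Sn factS.
have jk : j = k.
  by have /permP/(_ ord_max) := e; rewrite !permM !last_lift_max !tpermR.
by move: e; rewrite jk => /mulIg/last_lift_inj->.
Qed.

Variables (R : numFieldType) (V : nat -> lmodType R).
Variable A : forall m, 'S_m -> {linear V m -> V m}.
Hypothesis A_mul : forall m (s t : 'S_m) x, A t (A s x) = A (s * t)%g x.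

Definition alternating m (x : V m) := forall s : 'S_m, A s x = (-1) ^+ s *: x.

Definition alternate m (x : V m) : V m :=
  m`!%:R^-1 *: \sum_(s : 'S_m) (-1) ^+ s *: A s x.

Lemma fact_neq0 m : m`!%:R != 0 :> R.
Proof. by rewrite pnatr_eq0 -lt0n fact_gt0. Qed.

Lemma alternate_act m (t : 'S_m) x : alternate (A t x) = (-1) ^+ t *: alternate x.
Proof.
rewrite /alternate scalerA mulrC -scalerA; congr (_ *: _); rewrite scaler_sumr.
rewrite [RHS](reindex_inj (mulgI t)) /=; apply: eq_bigr => s _.
by rewrite A_mul scalerA odd_permM signr_addb signrMK.
Qed.

Lemma alternating_alternate m (x : V m) : alternating (alternate x).
Proof.
move=> t; rewrite /alternate linearZ /= scalerA mulrC -scalerA; congr (_ *: _).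
rewrite linear_sum scaler_sumr [RHS](reindex_inj (mulIg t)) /=.
apply: eq_bigr => s _.
by rewrite linearZ /= A_mul scalerA odd_permM addbC signr_addb signrMK.
Qed.

Lemma alternate_id m (x : V m) : alternating x -> alternate x = x.
Proof.
move=> x_alt; rewrite /alternate (eq_bigr (fun=> x)) => [|s _].
  rewrite sumr_const cardT -cardE card_Sn -scaler_nat scalerA.
  by rewrite mulVf ?fact_neq0 // scale1r.
by rewrite x_alt scalerA -expr2 sqrr_sign scale1r.
Qed.

Lemma alternate_is_linear m : linear (@alternate m).
Proof.
move=> a x y; rewrite /alternate scalerA mulrC -scalerA -scalerDr; congr (_ *: _).
rewrite scaler_sumr -big_split /=; apply: eq_bigr => s _.
by rewrite linearP scalerDr !scalerA mulrC.
Qed.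
HB.instance Definition _ m :=
  GRing.isLinear.Build R (V m) (V m) _ (@alternate m) (@alternate_is_linear m).

Lemma alternateZ m a (x : V m) : alternate (a *: x) = a *: alternate x.
Proof. exact: linearZ. Qed.

Lemma alternate0 m : alternate (0 : V m) = 0.
Proof. exact: linear0. Qed.

(** The m! permutations in a coset of the stabilizer of the last letter all
    contribute the same signed vector, so only the coset representatives
    remain. *)
Lemma alternate_swaps m (y : V m.+1) :
  (forall s : 'S_m, A (last_lift s) y = (-1) ^+ s *: y) ->
  m.+1%:R *: alternate y = y - \sum_(j < m) A (swap_last j) y.
Proof.
move=> y_alt; rewrite /alternate (reindex _ (onW_bij _ (@coset_bij m))) /=.
rewrite -(pair_bigA _ (fun j s => (-1) ^+ (last_lift s * tperm j ord_max)%g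
   *: A (last_lift s * tperm j ord_max)%g y)) /=.
have inner (j : 'I_m.+1) : \sum_(s : 'S_m) (-1) ^+ (last_lift s * tperm j ord_max)%g
   *: A (last_lift s * tperm j ord_max)%g y
   = m`!%:R *: ((-1) ^+ (j != ord_max) *: A (tperm j ord_max) y).
  rewrite (eq_bigr (fun=> (-1) ^+ (j != ord_max) *: A (tperm j ord_max) y)) => [|s _].
    by rewrite sumr_const cardT -cardE card_Sn scaler_nat.
  rewrite -A_mul y_alt linearZ scalerA odd_permM odd_last_lift odd_tperm addbC.
  by rewrite signr_addb -mulrA -expr2 sqrr_sign mulr1.
rewrite (eq_bigr _ (fun j _ => inner j)) -scaler_sumr !scalerA factS natrM invfM.
rewrite mulrA divff ?pnatr_eq0 // mul1r mulVf ?fact_neq0 // scale1r.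
rewrite (bigD1_ord ord_max) //= eqxx scale1r tperm1.
(* That A 1 acts as the identity is only known on y, as a case of y_alt. *)
have -> : A 1%g y = y.
  by have := y_alt 1%g; rewrite /last_lift lift_perm1 odd_perm1 scale1r.
congr (_ + _); rewrite -sumrN; apply: eq_bigr => j _.
by rewrite eq_sym neq_lift scaleN1r.
Qed.

Variables (up : forall m, {linear V m -> V m.+1})
  (down : forall m, {linear V m.+1 -> V m}) (k : R).
Hypothesis up_act : forall m (s : 'S_m) x,
  up m (A s x) = A (last_lift s) (up m x).
Hypothesis down_act : forall m (s : 'S_m) x,
  down m (A (last_lift s) x) = A s (down m x).
Hypothesis up_down : forall m (x : V m.+1),
  up m (down m x) = k *: x + down m.+1 (A (swap_last ord_max) (up m.+1 x)).

(** Expand both antisymmetrizations with [alternate_swaps] and let T be the term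
    [down (swap (up x))]. The transpositions of the new letter with a letter of x
    are conjugate, by permutations of the letters of x, to the one occurring in
    T; so they contribute, up to sign, T and its images under transpositions,
    and these cancel between the two expansions. *)
Lemma homotopy m (x : V m.+1) : alternating x ->
  m.+2%:R *: down m.+1 (alternate (up m.+1 x)) + m.+1%:R *: alternate (up m (down m x))
  = (k * m.+1%:R) *: x + down m.+1 (up m.+1 x).
Proof.
move=> x_alt; set T := down m.+1 (A (swap_last ord_max) (up m.+1 x)).
have swapT (j : 'I_m) :
    down m.+1 (A (swap_last (lift ord_max j)) (up m.+1 x)) = - A (swap_last j) T.
  rewrite swap_last_conj -!A_mul down_act -up_act x_alt odd_swap_last.
  by rewrite scaleN1r !linearN.
rewrite -linearZ /= alternate_swaps => [|s]; last by rewrite -up_act x_alt linearZ.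
rewrite alternate_swaps => [|s]; last first.
  by rewrite -up_act -down_act x_alt odd_last_lift !linearZ.
rewrite linearB linear_sum /= (bigD1_ord ord_max) //= -/T.
rewrite (eq_bigr _ (fun j _ => swapT j)) up_down -/T.
have swapU : \sum_(j < m) A (swap_last j) (k *: x + T) =
    - ((k *: x) *+ m) + \sum_(j < m) A (swap_last j) T.
  rewrite (eq_bigr (fun j => - (k *: x) + A (swap_last j) T)) => [|j _].
    by rewrite big_split /= sumr_const card_ord mulNrn.
  by rewrite linearD linearZ /= x_alt odd_swap_last scaleN1r scalerN.
rewrite swapU sumrN mulrC -scalerA scaler_nat mulrS.
set S := \sum_(i < m) _; set u := down _ _; set v := k *: x.
rewrite !opprD !opprK -addrA [RHS]addrC; congr (_ + _).
rewrite -[v + T + _]addrA [LHS]addrCA; congr (_ + _).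
by rewrite addrACA addNr add0r addrC subrK.
Qed.

(** An antisymmetrization in m letters is absorbed by one in m+1 letters. *)
Lemma alternate_up m (x : V m) : alternate (up m (alternate x)) = alternate (up m x).
Proof.
rewrite {2}/alternate !linearZ /= linear_sum (linear_sum (@alternate _)) /=.
rewrite (eq_bigr (fun=> alternate (up m x))) => [|s _]; last first.
  rewrite !linearZ /= up_act alternate_act odd_last_lift.
  by rewrite scalerA -expr2 sqrr_sign scale1r.
rewrite sumr_const cardT -cardE card_Sn -scaler_nat scalerA.
by rewrite mulVf ?fact_neq0 // scale1r.
Qed.

Lemma alternating_down m (x : V m.+1) : alternating x -> alternating (down m x).
Proof. by move=> x_alt s; rewrite -down_act x_alt odd_last_lift linearZ. Qed.

Lemma eq_opp0 (W : lmodType R) (x : W) : x = - x -> x = 0.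
Proof.
move/eqP; rewrite -addr_eq0 -mulr2n -scaler_nat scaler_eq0 pnatr_eq0 /=.
by move/eqP.
Qed.

(** The last two letters play the same role, which is incompatible with the sign
    of their transposition; the same holds in [alternate_up_up]. *)
Lemma down_down m (x : V m.+2) :
  (forall y, down m (down m.+1 (A (swap_last ord_max) y)) = down m (down m.+1 y)) ->
  alternating x -> down m (down m.+1 x) = 0.
Proof.
move=> sym x_alt; apply: eq_opp0.
by rewrite -[LHS]sym x_alt odd_swap_last scaleN1r !linearN.
Qed.

Lemma alternate_up_up m (x : V m) :
  (forall y, A (swap_last ord_max) (up m.+1 (up m y)) = up m.+1 (up m y)) ->
  alternate (up m.+1 (alternate (up m x))) = 0.
Proof.
move=> sym; rewrite alternate_up; apply: eq_opp0.
by rewrite -{1}sym alternate_act odd_swap_last scaleN1r.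
Qed.

End Ladder.

Section Equivariant.
Local Open Scope ring_scope.
Variables (R : numFieldType) (V W : nat -> lmodType R) (m : nat).
Variables (A : forall m, 'S_m -> {linear V m -> V m})
  (B : forall m, 'S_m -> {linear W m -> W m}).
Variable f : {linear V m -> W m}.
Hypothesis f_act : forall (s : 'S_m) x, f (A s x) = B s (f x).

Lemma equivariant_alternating x : alternating A x -> alternating B (f x).
Proof. by move=> x_alt s; rewrite -f_act x_alt linearZ. Qed.

Lemma equivariant_alternate x : f (alternate A x) = alternate B (f x).
Proof.
rewrite /alternate linearZ linear_sum; congr (_ *: _).
by apply: eq_bigr => s _; rewrite linearZ /= f_act.
Qed.

End Equivariant.

(** * Linear maps on formal sums of forests *)

Section Forests.
Local Open Scope ring_scope.
Local Open Scope quotient_scope.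
Variables (R : realType) (N : nat).
Local Notation basis := (@basis R N _ _).
Local Notation root := Defs.root.
Local Notation Span n p := (Span R N n p).

Definition iso_invariant n p (V : Type) (f : lforest N n p -> V) :=
  forall g h, iso g h -> f g = f h.

Lemma iso_invariant_comp n p (V W : Type) (F : V -> W) (f : lforest N n p -> V) :
  iso_invariant f -> iso_invariant (fun g => F (f g)).
Proof. by move=> f_iso g h /f_iso->. Qed.

Lemma basis_repr n p (h : forest N n p) :
  basis (generic_quotient.repr h) = [ffun h' => (h' == h)%:R].
Proof. by rewrite basis.unlock reprK. Qed.

Lemma extend_basis n p m q (f : lforest N n p -> Span m q) g :
  iso_invariant f -> extend f (basis g) = f g.
Proof.
move=> f_iso; rewrite /extend (bigD1 (\pi_(forest N n p) g)) //= big1 => [|h /negPf hg].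
  rewrite addr0 basis.unlock ffunE eqxx scale1r; apply: f_iso.
  by apply/eqmodP; rewrite reprK.
by rewrite basis.unlock ffunE hg scale0r.
Qed.

Lemma extend_extend n p m q l r (f : lforest N m q -> Span l r)
    (g : lforest N n p -> Span m q) x :
  extend f (extend g x) = extend (fun h => extend f (g h)) x.
Proof.
rewrite {2 3}/extend linear_sum.
by apply: eq_bigr => h _; rewrite linearZ.
Qed.

Lemma eq_extend n p m q (f g : lforest N n p -> Span m q) x :
  f =1 g -> extend f x = extend g x.
Proof. by move=> fg; apply: eq_bigr => h _; rewrite fg. Qed.

Lemma extend_id n p (x : Span n p) : extend (@Defs.basis R N n p) x = x.
Proof.
apply/ffunP=> h; rewrite /extend sum_ffunE (bigD1 h) //= big1 => [|h' /negPf h'h].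
  by rewrite basis_repr !ffunE eqxx addr0 [_ *: _]mulr1.
by rewrite basis_repr !ffunE eq_sym h'h scaler0.
Qed.

Lemma extendD n p m q (f g : lforest N n p -> Span m q) x :
  extend f x + extend g x = extend (fun h => f h + g h) x.
Proof. by rewrite /extend -big_split; apply: eq_bigr => h _; rewrite scalerDr. Qed.

Lemma scale_extend n p (k : R) (x : Span n p) :
  k *: x = extend (fun g => k *: basis g) x.
Proof.
rewrite -{1}(extend_id x) /extend scaler_sumr.
by apply: eq_bigr => h _; rewrite !scalerA mulrC.
Qed.

Definition act_roots p n (s : 'S_n) : {linear Span n p -> Span n p} :=
  extend (fun g => basis (act_root s g)).

Definition act_covs n p (s : 'S_p) : {linear Span n p -> Span n p} :=
  extend (fun g => basis (act_cov s g)).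

Lemma lforest_eq n p (g h : lforest N n p) :
  edges g = edges h -> root g =1 root h -> cov g =1 cov h -> g = h.
Proof.
move=> eE /ffunP rE /ffunP cE; apply: val_inj.
by rewrite /= [LHS]surjective_pairing [RHS]surjective_pairing
  [X in (X, _) = _]surjective_pairing [X in _ = (X, _)]surjective_pairing;
  congr (_, _, _).
Qed.

Lemma act_root_invariant n p (s : 'S_n) :
  iso_invariant (fun g : lforest N n p => basis (act_root s g)).
Proof.
move=> g h /existsP[t /iso_byP[tE tr tc]]; apply: (@basis_iso _ _ _ _ t).
by apply/iso_byP; split=> [u v|i|k]; rewrite ?ffunE; [exact: tE|exact: tr|exact: tc].
Qed.

Lemma act_cov_invariant n p (s : 'S_p) :
  iso_invariant (fun g : lforest N n p => basis (act_cov s g)).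
Proof.
move=> g h /existsP[t /iso_byP[tE tr tc]]; apply: (@basis_iso _ _ _ _ t).
by apply/iso_byP; split=> [u v|i|k]; rewrite ?ffunE; [exact: tE|exact: tr|exact: tc].
Qed.

Lemma act_rootsE n p (s : 'S_n) x :
  act_roots p s x = extend (fun g => basis (act_root s g)) x.
Proof. by []. Qed.

Lemma act_covsE n p (s : 'S_p) x :
  act_covs n s x = extend (fun g => basis (act_cov s g)) x.
Proof. by []. Qed.

Lemma act_roots_mul p n (s t : 'S_n) x :
  act_roots p t (act_roots p s x) = act_roots p (s * t)%g x.
Proof.
rewrite !act_rootsE extend_extend; apply: eq_extend => g.
rewrite extend_basis; [|exact: act_root_invariant]; congr basis.
by apply: lforest_eq => //= i; rewrite /root /= !ffunE invMg permM.
Qed.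

Lemma act_covs_mul n p (s t : 'S_p) x :
  act_covs n t (act_covs n s x) = act_covs n (s * t)%g x.
Proof.
rewrite !act_covsE extend_extend; apply: eq_extend => g.
rewrite extend_basis; [|exact: act_cov_invariant]; congr basis.
by apply: lforest_eq => //= i; rewrite /cov /= !ffunE invMg permM.
Qed.

Lemma wedge_root_alternate p n (x : Span n p) :
  extend (@wedge_root_lf R N n p) x = alternate (act_roots p) x.
Proof.
rewrite /extend /wedge_root_lf /alternate.
rewrite (eq_bigr (fun h => n`!%:R^-1 *: \sum_(s : 'S_n)
   (-1) ^+ s *: (x h *: basis (act_root s (generic_quotient.repr h))))) => [|h _].
  by rewrite -scaler_sumr exchange_big; congr (_ *: _); apply: eq_bigr => s _;
    rewrite -scaler_sumr.
rewrite scalerA mulrC -scalerA scaler_sumr; congr (_ *: _).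
by apply: eq_bigr => s _; rewrite !scalerA mulrC.
Qed.

Lemma wedge_cov_alternate n p (x : Span n p) :
  extend (@wedge_cov_lf R N n p) x = alternate (act_covs n) x.
Proof.
rewrite /extend /wedge_cov_lf /alternate.
rewrite (eq_bigr (fun h => p`!%:R^-1 *: \sum_(s : 'S_p)
   (-1) ^+ s *: (x h *: basis (act_cov s (generic_quotient.repr h))))) => [|h _].
  by rewrite -scaler_sumr exchange_big; congr (_ *: _); apply: eq_bigr => s _;
    rewrite -scaler_sumr.
rewrite scalerA mulrC -scalerA scaler_sumr; congr (_ *: _).
by apply: eq_bigr => s _; rewrite !scalerA mulrC.
Qed.

Lemma act_roots_covs n p (s : 'S_n) (t : 'S_p) x :
  act_roots p s (act_covs n t x) = act_covs n t (act_roots p s x).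
Proof.
rewrite !act_rootsE !act_covsE !extend_extend; apply: eq_extend => g.
rewrite !extend_basis; [|exact: act_cov_invariant|exact: act_root_invariant].
by congr basis; apply: lforest_eq.
Qed.

Lemma wedgeE n p (x : Span n p) :
  wedge R N n p x = alternate (act_roots p) (alternate (act_covs n) x).
Proof.
by rewrite /wedge !lfunE /= !lfunE /= wedge_root_alternate wedge_cov_alternate.
Qed.

(** Antisymmetrization is a projection, so membership in its image is the
    condition of being alternating, in the roots and in the covertices. *)
Lemma mem_Omega n p (x : Span n p) : x \in Omega R N n p <->
  alternating (act_roots p) x /\ alternating (act_covs n) x.
Proof.
split=> [/memv_imgP[y _ ->]|[xr xc]].
  rewrite wedgeE; split; first exact/alternating_alternate/act_roots_mul.
  move=> t; rewrite (equivariant_alternate (V := fun n => Span n p)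
      (W := fun n => Span n p) (B := act_roots p) (f := act_covs n t)) => [|s z].
    by rewrite (alternating_alternate (V := fun p => Span n p) (@act_covs_mul n)) linearZ.
  exact/esym/act_roots_covs.
apply/memv_imgP; exists x; rewrite ?memvf // wedgeE.
by rewrite (alternate_id xc) (alternate_id xr).
Qed.

(** * Cutting edges and marking covertices *)

Definition raw_forest n p :=
  ({set 'I_N * 'I_N} * {ffun 'I_n -> 'I_N} * {ffun 'I_p -> 'I_N})%type.

(** Being zero on triples that are not forests lets sums over nodes be written
    without carrying a proof that each term is a forest. *)
Definition raw_basis n p (x : raw_forest n p) : Span n p := oapp basis 0 (insub x).

Lemma raw_basisE n p (x : raw_forest n p) (x_forest : is_forest x) :
  raw_basis x = basis (LForest x_forest).
Proof. by rewrite /raw_basis insubT. Qed.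

Definition snoc n (r : {ffun 'I_n -> 'I_N}) (a : 'I_N) : {ffun 'I_n.+1 -> 'I_N} :=
  [ffun i => oapp r a (unlift ord_max i)].

Lemma snoc_lift n (r : {ffun 'I_n -> 'I_N}) a i : snoc r a (lift ord_max i) = r i.
Proof. by rewrite ffunE liftK. Qed.

Lemma snoc_max n (r : {ffun 'I_n -> 'I_N}) a : snoc r a ord_max = a.
Proof. by rewrite ffunE unlift_none. Qed.

Definition cut_edge n p (g : lforest N n p) (a : 'I_N) : raw_forest n.+1 p :=
  (edges g :\: [set e | e.1 == a], snoc (root g) a, cov g).

Lemma mem_roots n p (g : lforest N n p) u :
  is_root (edges g) u = (u \in codom (root g)).
Proof. by have [_ /andP[_ /forallP/(_ u)/eqP->] _] := lforestP g. Qed.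

Lemma root_inj n p (g : lforest N n p) : injective (root g).
Proof. by have [_ /andP[/injectiveP]] := lforestP g. Qed.

Lemma cov_inj n p (g : lforest N n p) : injective (cov g).
Proof. by have [_ _ /injectiveP] := lforestP g. Qed.

Lemma edges_fun n p (g : lforest N n p) u v w :
  (u, v) \in edges g -> (u, w) \in edges g -> v = w.
Proof.
have [/forallP/(_ u)/forallP/(_ v)/forallP/(_ w)/implyP fE _ _] := lforestP g.
by move=> /fE/implyP uw /uw/eqP.
Qed.

Lemma nonrootP n p (g : lforest N n p) a :
  reflect (exists u, (a, u) \in edges g) (~~ is_root (edges g) a).
Proof.
rewrite negb_forall.
by apply: (iffP existsP) => -[u au]; exists u; move: au; rewrite negbK.
Qed.

Lemma cut_edge_forest n p (g : lforest N n p) (a : 'I_N) :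
  ~~ is_root (edges g) a -> is_forest (cut_edge g a).
Proof.
move=> a_nonroot; apply/and3P; split => /=.
- apply/forallP=> u; apply/forallP=> v; apply/forallP=> w.
  apply/implyP=> uv; apply/implyP=> uw; apply/eqP.
  by move: uv uw; rewrite !inE => /andP[_ uv] /andP[_]; apply: edges_fun uv.
- apply/andP; split.
    apply/injectiveP=> i j; case: (unliftP ord_max i) => [i' ->|->];
      case: (unliftP ord_max j) => [j' ->|->]; rewrite ?snoc_lift ?snoc_max //.
    + by move/root_inj->.
    + by move=> ra; rewrite mem_roots -ra codom_f in a_nonroot.
    + by move=> ra; rewrite mem_roots ra codom_f in a_nonroot.
  apply/forallP=> u; apply/eqP.
  have [->|ua] := eqVneq u a.
    rewrite -{1}(snoc_max (root g) a) codom_f.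
    by apply/esym/forallP=> v; rewrite !inE eqxx.
  have -> : is_root (edges g :\: [set e | e.1 == a]) u = is_root (edges g) u.
    by apply: eq_forallb => v; rewrite !inE /= ua.
  rewrite mem_roots; apply/codomP/codomP=> -[i].
    case: (unliftP ord_max i) => [i' ->|->]; rewrite ?snoc_lift ?snoc_max => ui.
      by exists i'.
    by rewrite ui eqxx in ua.
  by move->; exists (lift ord_max i); rewrite snoc_lift.
by have [_ _] := lforestP g.
Qed.

Definition cut_lf n p (g : lforest N n p) : Span n.+1 p :=
  \sum_(a | ~~ is_root (edges g) a) raw_basis (cut_edge g a).

Definition cut p n : {linear Span n p -> Span n.+1 p} := extend (@cut_lf n p).

Lemma iso_is_root n p (s : 'S_N) (g h : lforest N n p) u :
  iso_by s g h -> is_root (edges h) (s u) = is_root (edges g) u.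
Proof.
case/iso_byP=> sE _ _; apply/forallP/forallP=> uE v; first by rewrite -sE.
by rewrite -(permKV s v) sE.
Qed.

Lemma cut_invariant n p : iso_invariant (@cut_lf n p).
Proof.
move=> g h /existsP[s gh]; rewrite /cut_lf [RHS](reindex_inj (@perm_inj _ s)) /=.
apply: eq_big => [a|a a_nonroot]; first by rewrite (iso_is_root _ gh).
have sa_nonroot : ~~ is_root (edges h) (s a) by rewrite (iso_is_root _ gh).
rewrite (raw_basisE (cut_edge_forest a_nonroot)).
rewrite (raw_basisE (cut_edge_forest sa_nonroot)).
apply: (@basis_iso _ _ _ _ s); have /iso_byP[sE sr sc] := gh.
apply/iso_byP; split=> [u v|i|k]; rewrite /edges /root /cov /=.
- by rewrite !inE /= sE (inj_eq perm_inj).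
- by case: (unliftP ord_max i) => [i' ->|->]; rewrite ?snoc_lift ?snoc_max.
exact: sc.
Qed.

Lemma add_cov_forest n p (g : lforest N n p) v :
  is_vertex g v -> is_forest (edges g, root g, snoc (cov g) v).
Proof. by move=> v_vtx; exact: (to_cov_subproof (exist (is_vertex g) v v_vtx)). Qed.

Lemma sum_to_covE n p (g : lforest N n p) : sum_to_cov_lf R g =
  \sum_(v | is_vertex g v) raw_basis (edges g, root g, snoc (cov g) v).
Proof.
rewrite [RHS](big_sub (is_vertex g)); apply: eq_bigr => v _.
by rewrite (raw_basisE (to_cov_subproof v)).
Qed.

Lemma forget_cov_subproof n p (g : lforest N n p.+1) :
  is_forest (edges g, root g, [ffun k : 'I_p => cov g (lift ord_max k)]).
Proof.
have [fE rE c_inj] := lforestP g; apply/and3P; split=> //=.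
by apply/injectiveP=> i j; rewrite !ffunE => /cov_inj/lift_inj.
Qed.
Definition forget_cov_lf n p (g : lforest N n p.+1) : lforest N n p :=
  LForest (forget_cov_subproof g).

Definition forget_cov n p : {linear Span n p.+1 -> Span n p} :=
  extend (fun g => basis (forget_cov_lf g)).

Definition add_cov n p : {linear Span n p -> Span n p.+1} :=
  extend (@sum_to_cov_lf R N n p).

Definition graft p n : {linear Span n.+1 p -> Span n p} := extend (@dH_lf R N n p).

Lemma forget_cov_invariant n p :
  iso_invariant (fun g : lforest N n p.+1 => basis (forget_cov_lf g)).
Proof.
move=> g h /existsP[t /iso_byP[tE tr tc]]; apply: (@basis_iso _ _ _ _ t).
by apply/iso_byP; split=> [u v|i|k]; rewrite ?ffunE; [exact: tE|exact: tr|exact: tc].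
Qed.

Lemma cutE n p (x : Span n p) : cut p n x = extend (@cut_lf n p) x.
Proof. by []. Qed.
Lemma graftE n p (x : Span n.+1 p) : graft p n x = extend (@dH_lf R N n p) x.
Proof. by []. Qed.
Lemma add_covE n p (x : Span n p) : add_cov n p x = extend (@sum_to_cov_lf R N n p) x.
Proof. by []. Qed.
Lemma forget_covE n p (x : Span n p.+1) :
  forget_cov n p x = extend (fun g => basis (forget_cov_lf g)) x.
Proof. by []. Qed.

Lemma rootE n p x (x_forest : @is_forest N n p x) : root (LForest x_forest) = x.1.2.
Proof. by []. Qed.
Lemma covE n p x (x_forest : @is_forest N n p x) : cov (LForest x_forest) = x.2.
Proof. by []. Qed.
Lemma edgesE n p x (x_forest : @is_forest N n p x) : edges (LForest x_forest) = x.1.1.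
Proof. by []. Qed.

(** * The roots: cutting and grafting *)

Lemma cut_act p n (s : 'S_n) x :
  cut p n (act_roots p s x) = act_roots p (last_lift s) (cut p n x).
Proof.
rewrite !cutE !act_rootsE !extend_extend; apply: eq_extend => g.
rewrite extend_basis; last exact: cut_invariant.
rewrite linear_sum /=; apply: eq_bigr => a a_nonroot.
rewrite (raw_basisE (cut_edge_forest a_nonroot)).
rewrite (raw_basisE (cut_edge_forest (g := g) a_nonroot)).
rewrite extend_basis; last exact: act_root_invariant.
congr basis; apply: lforest_eq => // i; rewrite !rootE /= [RHS]ffunE last_liftV.
by case: (unliftP ord_max i) => [i' ->|->];
  rewrite ?last_liftE ?last_lift_max ?snoc_lift ?snoc_max // ffunE.
Qed.

Lemma graft_act p n (s : 'S_n) x :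
  graft p n (act_roots p (last_lift s) x) = act_roots p s (graft p n x).
Proof.
rewrite !graftE !act_rootsE !extend_extend; apply: eq_extend => g.
rewrite extend_basis; last exact: dH_lf_iso.
rewrite linear_sum /=; apply: eq_bigr => u _.
rewrite extend_basis; last exact: act_root_invariant.
congr basis; apply: lforest_eq => [|i|//].
  by rewrite !edgesE /= rootE ffunE last_liftV last_lift_max.
by rewrite !rootE !ffunE /= last_liftV last_liftE.
Qed.

Lemma cut_covs p n (t : 'S_p) x :
  cut p n (act_covs n t x) = act_covs n.+1 t (cut p n x).
Proof.
rewrite !cutE !act_covsE !extend_extend; apply: eq_extend => g.
rewrite extend_basis; last exact: cut_invariant.
rewrite linear_sum /=; apply: eq_bigr => a a_nonroot.
rewrite (raw_basisE (cut_edge_forest a_nonroot)).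
rewrite (raw_basisE (cut_edge_forest (g := g) a_nonroot)).
rewrite extend_basis; last exact: act_cov_invariant.
by congr basis; apply: lforest_eq.
Qed.

Lemma graft_covs p n (t : 'S_p) x :
  graft p n (act_covs n.+1 t x) = act_covs n t (graft p n x).
Proof.
rewrite !graftE !act_covsE !extend_extend; apply: eq_extend => g.
rewrite extend_basis; last exact: dH_lf_iso.
rewrite linear_sum /=; apply: eq_bigr => u _.
rewrite extend_basis; last exact: act_cov_invariant.
by congr basis; apply: lforest_eq.
Qed.

Lemma graft_graft p n (x : Span n.+2 p) :
  graft p n (graft p n.+1 (act_roots p (swap_last ord_max) x))
  = graft p n (graft p n.+1 x).
Proof.
rewrite !graftE !act_rootsE !extend_extend; apply: eq_extend => g.
rewrite extend_basis; last exact/iso_invariant_comp/dH_lf_iso.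
rewrite !linear_sum /=.
have twice (h : lforest N n.+2 p) u :
      extend (@dH_lf R N n p) (basis (add_edge h u))
      = \sum_v basis (add_edge (add_edge h u) v).
  by rewrite extend_basis //; exact: dH_lf_iso.
rewrite (eq_bigr _ (fun u _ => twice _ u)) [RHS](eq_bigr _ (fun u _ => twice _ u)).
rewrite exchange_big; apply: eq_bigr => u _; apply: eq_bigr => v _; congr basis.
apply: lforest_eq => [|i|//]; rewrite ?edgesE ?rootE /= ?ffunE /= ?rootE ?ffunE.
  by rewrite /swap_last tpermV tpermL tpermR setUCA.
by rewrite /swap_last tpermV tpermD // ?(inj_eq lift_inj) neq_lift.
Qed.

Lemma add_edge_is_root n p (g : lforest N n.+1 p) u a :
  is_root (edges (add_edge g u)) a = is_root (edges g) a && (a != root g ord_max).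
Proof.
rewrite edgesE /=; apply/forallP/andP=> [aE|[/forallP aE ra] v].
  split; first by apply/forallP=> v; have := aE v; rewrite !inE negb_or => /andP[].
  by have := aE u; rewrite !inE negb_or xpair_eqE eqxx andbT => /andP[].
by rewrite !inE negb_or xpair_eqE (negPf ra) aE.
Qed.

Lemma cut_add_edge n p (g : lforest N n.+1 p) u :
  raw_basis (cut_edge (add_edge g u) (root g ord_max)) = basis g.
Proof.
have ra : ~~ is_root (edges (add_edge g u)) (root g ord_max).
  by rewrite add_edge_is_root eqxx andbF.
rewrite (raw_basisE (cut_edge_forest ra)); congr basis; apply: lforest_eq => [|i|//].
  apply/setP=> -[v w]; rewrite edgesE /= !inE xpair_eqE /=.
  by have [->|] //= := eqVneq v (root g ord_max); rewrite (negPf (root_no_edge _ _ _)).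
by rewrite rootE /=; case: (unliftP ord_max i) => [i' ->|->];
  rewrite ?snoc_lift ?snoc_max // ffunE.
Qed.

(** After the last root r of a forest is grafted on u, either the new edge is cut
    again, which returns the forest, once for each of the N choices of u, or an
    old edge out of a node a is cut. The latter is the result of cutting that
    edge first and then grafting r, provided r and a exchange their numbers. *)
Lemma cut_graft p n (x : Span n.+1 p) :
  cut p n (graft p n x)
  = N%:R *: x + graft p n.+1 (act_roots p (swap_last ord_max) (cut p n.+1 x)).
Proof.
rewrite !graftE !act_rootsE !cutE !extend_extend scale_extend extendD.
apply: eq_extend => g.
rewrite !linear_sum /=.
have step u : extend (@cut_lf n p) (basis (add_edge g u)) = basis g +
    \sum_(a | ~~ is_root (edges g) a) raw_basis (cut_edge (add_edge g u) a).
  rewrite extend_basis; last exact: cut_invariant.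
  rewrite /cut_lf (bigD1 (root g ord_max)) /=; last first.
    by rewrite add_edge_is_root eqxx andbF.
  rewrite cut_add_edge; congr (_ + _); apply: eq_bigl => a.
  rewrite add_edge_is_root negb_and negbK andb_orl andbN orbF.
  have [->|] := eqVneq a; last by rewrite andbT.
  by rewrite andbF mem_roots codom_f.
rewrite (eq_bigr _ (fun u _ => step u)) big_split /= sumr_const card_ord scaler_nat.
congr (_ + _); rewrite exchange_big; apply: eq_bigr => a a_nonroot.
rewrite (raw_basisE (cut_edge_forest a_nonroot)).
rewrite extend_basis; last exact/iso_invariant_comp/act_root_invariant.
rewrite extend_basis; last exact: dH_lf_iso.
apply: eq_bigr => u _.
have a_nonroot' : ~~ is_root (edges (add_edge g u)) a.
  by rewrite add_edge_is_root negb_and a_nonroot.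
rewrite (raw_basisE (cut_edge_forest a_nonroot')); congr basis.
have ra : root g ord_max != a.
  by apply: contraNneq a_nonroot => <-; rewrite mem_roots codom_f.
apply: lforest_eq => [|i|//].
  rewrite !edgesE /= rootE /= ffunE /swap_last tpermV tpermR snoc_lift.
  apply/setP=> -[v w]; rewrite !inE !xpair_eqE /=.
  by have [->|] //= := eqVneq v a; rewrite eq_sym (negPf ra).
rewrite !rootE /= [RHS]ffunE rootE /= [RHS]ffunE /swap_last tpermV.
case: (unliftP ord_max i) => [i' ->|->]; rewrite ?snoc_lift ?snoc_max.
  rewrite ffunE tpermD ?snoc_lift // ?neq_lift //.
  by rewrite (inj_eq lift_inj) neq_lift.
by rewrite tpermL snoc_max.
Qed.

(** * The covertices: marking and forgetting *)

Lemma add_cov_act n p (s : 'S_p) x :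
  add_cov n p (act_covs n s x) = act_covs n (last_lift s) (add_cov n p x).
Proof.
rewrite !add_covE !act_covsE !extend_extend; apply: eq_extend => g.
rewrite extend_basis; last exact: sum_to_cov_lf_iso.
rewrite !sum_to_covE linear_sum /=.
have vtxE v : is_vertex (act_cov s g) v = is_vertex g v.
  by rewrite /is_vertex covE /= mem_codom_comp.
apply: eq_big => [v|v v_vtx]; first exact: vtxE.
have v_vtx' : is_vertex g v by rewrite -vtxE.
rewrite (raw_basisE (add_cov_forest v_vtx)).
rewrite (raw_basisE (add_cov_forest v_vtx')).
rewrite extend_basis; last exact: act_cov_invariant.
congr basis; apply: lforest_eq => // i; rewrite !covE /= [RHS]ffunE last_liftV.
by case: (unliftP ord_max i) => [i' ->|->];
  rewrite ?last_liftE ?last_lift_max ?snoc_lift ?snoc_max //= ?covE ffunE.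
Qed.

Lemma forget_cov_act n p (s : 'S_p) x :
  forget_cov n p (act_covs n (last_lift s) x) = act_covs n s (forget_cov n p x).
Proof.
rewrite !forget_covE !act_covsE !extend_extend; apply: eq_extend => g.
rewrite extend_basis; last exact: forget_cov_invariant.
rewrite extend_basis; last exact: act_cov_invariant.
congr basis; apply: lforest_eq => // i.
by rewrite !covE !ffunE /= last_liftV last_liftE.
Qed.

Lemma add_cov_roots n p (s : 'S_n) x :
  add_cov n p (act_roots p s x) = act_roots p.+1 s (add_cov n p x).
Proof.
rewrite !add_covE !act_rootsE !extend_extend; apply: eq_extend => g.
rewrite extend_basis; last exact: sum_to_cov_lf_iso.
rewrite !sum_to_covE linear_sum /=; apply: eq_bigr => v v_vtx.
rewrite (raw_basisE (add_cov_forest v_vtx)).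
rewrite (raw_basisE (add_cov_forest (g := g) v_vtx)).
rewrite extend_basis; last exact: act_root_invariant.
by congr basis; apply: lforest_eq.
Qed.

Lemma forget_cov_roots n p (s : 'S_n) x :
  forget_cov n p (act_roots p.+1 s x) = act_roots p s (forget_cov n p x).
Proof.
rewrite !forget_covE !act_rootsE !extend_extend; apply: eq_extend => g.
rewrite extend_basis; last exact: forget_cov_invariant.
rewrite extend_basis; last exact: act_root_invariant.
by congr basis; apply: lforest_eq.
Qed.

Lemma forget_add_cov n p (x : Span n p) :
  forget_cov n p (add_cov n p x) = (N%:R - p%:R) *: x.
Proof.
rewrite add_covE forget_covE extend_extend scale_extend; apply: eq_extend => g.
rewrite sum_to_covE linear_sum /= (eq_bigr (fun=> basis g)) => [|v v_vtx]; last first.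
  rewrite (raw_basisE (add_cov_forest v_vtx)).
  rewrite extend_basis; last exact: forget_cov_invariant.
  congr basis; apply: lforest_eq => // i.
  by rewrite !covE /= ffunE snoc_lift.
rewrite sumr_const -scaler_nat -[X in _ = (X%:R - _) *: _](card_ord N).
rewrite -(cardC (mem (codom (cov g)))) (card_codom (@cov_inj _ _ g)) card_ord.
by rewrite natrD [_ + _%:R]addrC addrK.
Qed.

Lemma forget_cov_is_vertex n p (g : lforest N n p.+1) v :
  is_vertex (forget_cov_lf g) v = is_vertex g v || (v == cov g ord_max).
Proof.
rewrite /is_vertex covE /=; have [->|v_last] := eqVneq v.
  rewrite orbT; apply/codomP=> -[i]; rewrite ffunE => /cov_inj/eqP.
  by rewrite (negPf (neq_lift _ _)).
rewrite orbF; congr (~~ _); apply/codomP/codomP=> -[i vi].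
  by exists (lift ord_max i); rewrite vi ffunE.
case: (unliftP ord_max i) vi => [i' ->|->] vi; first by exists i'; rewrite ffunE.
by rewrite vi eqxx in v_last.
Qed.

(** After the last covertex c is forgotten, the vertices to mark are c itself,
    which returns the forest, and the old vertices v. The latter case is the
    result of marking v first and then forgetting c, provided c and v exchange
    their numbers. *)
Lemma add_forget_cov n p (x : Span n p.+1) :
  add_cov n p (forget_cov n p x)
  = 1 *: x + forget_cov n p.+1 (act_covs n (swap_last ord_max) (add_cov n p.+1 x)).
Proof.
rewrite !add_covE !act_covsE !forget_covE !extend_extend scale_extend extendD.
apply: eq_extend => g; rewrite scale1r.
rewrite extend_basis; last exact: sum_to_cov_lf_iso.
rewrite !sum_to_covE linear_sum /=.
have last_vtx : is_vertex (forget_cov_lf g) (cov g ord_max).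
  by rewrite forget_cov_is_vertex eqxx orbT.
rewrite (bigD1 (cov g ord_max)) //=; congr (_ + _).
  rewrite (raw_basisE (add_cov_forest last_vtx)).
  congr basis; apply: lforest_eq => // i; rewrite covE /=.
  by case: (unliftP ord_max i) => [i' ->|->]; rewrite ?snoc_lift ?snoc_max // covE ffunE.
apply: eq_big => [v|v /andP[v_vtx v_last]].
  rewrite forget_cov_is_vertex andb_orl andbN orbF.
  have [->|] := eqVneq v; last by rewrite andbT.
  by rewrite andbF /is_vertex codom_f.
have v_vtx' : is_vertex g v.
  by move: v_vtx; rewrite forget_cov_is_vertex (negPf v_last) orbF.
rewrite (raw_basisE (add_cov_forest v_vtx)).
rewrite (raw_basisE (add_cov_forest v_vtx')).
rewrite extend_basis; last exact/iso_invariant_comp/act_cov_invariant.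
rewrite extend_basis; last exact: forget_cov_invariant.
congr basis; apply: lforest_eq => // i.
rewrite !covE /= [RHS]ffunE [RHS]ffunE /swap_last tpermV.
case: (unliftP ord_max i) => [i' ->|->]; rewrite ?snoc_lift ?snoc_max.
  rewrite ffunE tpermD ?snoc_lift // ?neq_lift //.
  by rewrite (inj_eq lift_inj) neq_lift.
by rewrite tpermL snoc_max.
Qed.

Lemma add_cov_is_vertex n p (g : lforest N n p) v (v_vtx : is_vertex g v) w :
  is_vertex (LForest (add_cov_forest v_vtx)) w = is_vertex g w && (w != v).
Proof.
rewrite /is_vertex covE /= -negb_or; congr (~~ _).
apply/codomP/orP=> [[i]|[/codomP[i ->]|/eqP->]].
- case: (unliftP ord_max i) => [i' ->|->]; rewrite ?snoc_lift ?snoc_max => ->.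
    by left; exact: codom_f.
  by right.
- by exists (lift ord_max i); rewrite snoc_lift.
by exists ord_max; rewrite snoc_max.
Qed.

Lemma add_cov2_forest n p (g : lforest N n p) v w :
  is_vertex g v -> is_vertex g w && (w != v) ->
  is_forest (edges g, root g, snoc (snoc (cov g) v) w).
Proof.
move=> v_vtx; rewrite -(add_cov_is_vertex v_vtx) => w_vtx.
exact: (add_cov_forest w_vtx).
Qed.

Lemma sum_to_cov_twice n p (g : lforest N n p) :
  extend (@sum_to_cov_lf R N n p.+1) (sum_to_cov_lf R g) =
  \sum_(v | is_vertex g v) \sum_(w | is_vertex g w && (w != v))
    raw_basis (edges g, root g, snoc (snoc (cov g) v) w).
Proof.
rewrite sum_to_covE linear_sum; apply: eq_bigr => v v_vtx /=.
rewrite (raw_basisE (add_cov_forest v_vtx)).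
rewrite extend_basis; last exact: sum_to_cov_lf_iso.
by rewrite sum_to_covE; apply: eq_bigl => w; exact: add_cov_is_vertex.
Qed.

Lemma add_add_cov n p (x : Span n p) :
  act_covs n (swap_last ord_max) (add_cov n p.+1 (add_cov n p x))
  = add_cov n p.+1 (add_cov n p x).
Proof.
rewrite !add_covE act_covsE (extend_extend _ _ x) extend_extend.
apply: eq_extend => g; rewrite sum_to_cov_twice linear_sum /=.
rewrite [RHS](exchange_big_dep (is_vertex g)) => [|v w _ /andP[] //].
apply: eq_bigr => v v_vtx; rewrite linear_sum /=.
apply: eq_big => [w|w w_vtx]; first by rewrite v_vtx eq_sym.
have v_vtx' : is_vertex g v && (v != w).
  by rewrite v_vtx eq_sym; case/andP: w_vtx.
rewrite (raw_basisE (add_cov2_forest v_vtx w_vtx)).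
rewrite (raw_basisE (add_cov2_forest (proj1 (andP w_vtx)) v_vtx')).
rewrite extend_basis; last exact: act_cov_invariant.
congr basis; apply: lforest_eq => // i; rewrite !covE /= [LHS]ffunE /swap_last tpermV.
case: (unliftP ord_max i) => [i' ->|->].
  case: (unliftP ord_max i') => [j ->|->].
    by rewrite tpermD ?neq_lift ?(inj_eq lift_inj) ?neq_lift // !snoc_lift.
  by rewrite tpermL !snoc_max snoc_lift snoc_max.
by rewrite tpermR snoc_max snoc_lift snoc_max.
Qed.

(** * Injectivity of the Laplacian *)

(** A labelled forest g arises from k by grafting the last root on u in exactly
    one way for each node a that is not a root of g: then a is the last root of
    k and the edge of g out of a goes to u. So cutting is the transpose of
    grafting on labelled forests; on isomorphism classes, automorphisms would
    introduce weights. *)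
Lemma sum_add_edge_preimage n p (g : lforest N n p) :
  \sum_(ku : lforest N n.+1 p * 'I_N | add_edge ku.1 ku.2 == g) basis ku.1 = cut_lf g.
Proof.
rewrite (partition_big (fun ku => root ku.1 ord_max)
                       (fun a => ~~ is_root (edges g) a))
  => [|[k u] /= /eqP<-]; last by rewrite add_edge_is_root eqxx andbF.
apply: eq_bigr => a a_nonroot; have /nonrootP[u au] := a_nonroot.
rewrite (big_pred1 (LForest (cut_edge_forest a_nonroot), u)) => [|[k v]].
  by rewrite (raw_basisE (cut_edge_forest a_nonroot)).
rewrite /= xpair_eqE; apply/andP/andP=> [[/eqP kv /eqP ra]|[/eqP kE /eqP->]].
  subst g; split; last first.
    by apply/eqP; apply: edges_fun au; rewrite edgesE /= ra !inE eqxx.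
  apply/eqP/lforest_eq => [|i|i]; rewrite ?edgesE ?rootE ?covE //=.
    apply/setP=> -[w x]; rewrite !inE -ra /=.
    have [->|] /= := eqVneq w; first by rewrite (negPf (root_no_edge _ _ _)).
    by move=> /negPf wr; rewrite xpair_eqE wr.
  case: (unliftP ord_max i) => [i' ->|->]; rewrite ?snoc_lift ?snoc_max //.
  by rewrite rootE ffunE.
have ra : root k ord_max = a by rewrite kE rootE snoc_max.
rewrite ra; split=> //; apply/eqP/lforest_eq => [|i|i]; rewrite ?edgesE ?rootE ?covE //=.
- rewrite ra kE edgesE /=; apply/setP=> -[w x]; rewrite !inE xpair_eqE /=.
  have [->|] //= := eqVneq w a; rewrite orbF.
  by apply/eqP/idP => [->//|ax]; apply: edges_fun ax au.
- by rewrite ffunE kE rootE snoc_lift.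
by rewrite kE.
Qed.

Definition pairing n p (y x : Span n p) : R := \sum_(h : forest N n p) x h * y h.

Lemma pairing_linear n p (y : Span n p) : linear (pairing y : Span n p -> R^o).
Proof.
move=> a x x'; rewrite /pairing scaler_sumr -big_split /=.
by apply: eq_bigr => h _; rewrite !ffunE mulrDl [_ *: x h]/(_ * _) -mulrA.
Qed.
HB.instance Definition _ n p y :=
  GRing.isLinear.Build R (Span n p) R^o _ (pairing y) (@pairing_linear n p y).

Lemma pairing_basis n p (y : Span n p) g :
  pairing y (basis g) = y (\pi_(forest N n p) g).
Proof.
rewrite /pairing (bigD1 (\pi_(forest N n p) g)) //= big1 => [|h /negPf hg].
  by rewrite basis.unlock ffunE eqxx mul1r addr0.
by rewrite basis.unlock ffunE hg mul0r.
Qed.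

Section Laplacian.
Variables (n p : nat) (c : R) (c_gt0 : 0 < c).

Definition laplacian (x : Span n p) : Span n p := c *: x + graft p n (cut p n x).

Lemma laplacian_is_linear : linear laplacian.
Proof.
by move=> a x y; rewrite /laplacian !linearP /= addrACA !scalerA mulrC.
Qed.
HB.instance Definition _ :=
  GRing.isLinear.Build R (Span n p) (Span n p) _ laplacian laplacian_is_linear.

(** The transpose of the Laplacian for [pairing]. Seen as an operator on the
    isomorphism invariant functions of labelled forests, it involves no
    automorphism weights, and its quadratic form is a sum of squares. *)
Definition laplacian_tr (y : Span n p) : Span n p :=
  [ffun h : forest N n p => pairing y (laplacian (basis (generic_quotient.repr h)))].

Lemma laplacian_tr_is_linear : linear laplacian_tr.
Proof.
move=> a x y; apply/ffunP => h; rewrite !ffunE /pairing scaler_sumr -big_split /=.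
apply: eq_bigr => h' _; rewrite !ffunE mulrDr; congr (_ + _); exact: mulrCA.
Qed.
HB.instance Definition _ :=
  GRing.isLinear.Build R (Span n p) (Span n p) _ laplacian_tr laplacian_tr_is_linear.

Lemma pairing_laplacian x y : pairing (laplacian_tr y) x = pairing y (laplacian x).
Proof.
rewrite -[in RHS](extend_id x) /extend !linear_sum /=; apply: eq_bigr => h _.
by rewrite !linearZ ffunE.
Qed.

(** Let Y be the function on labelled forests induced by y, and Z k the sum of Y
    over the graftings of k. Pairing [laplacian_tr y] with Y over all labelled
    forests gives c times the sum of the squares of Y plus the sum of the
    squares of Z. *)
Lemma laplacian_tr_inj y : laplacian_tr y = 0 -> y = 0.
Proof.
move=> y0.
pose Y (g : lforest N n p) : R := pairing y (basis g).
pose Z (k : lforest N n.+1 p) : R := pairing y (graft p n (basis k)).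
have ZE k : Z k = \sum_u Y (add_edge k u).
  rewrite /Z graftE extend_basis; last exact: dH_lf_iso.
  exact: linear_sum.
have Yeq g : c * Y g + \sum_(ku : lforest N n.+1 p * 'I_N |
    add_edge ku.1 ku.2 == g) Z ku.1 = 0.
  have := pairing_laplacian (basis g) y; rewrite y0 /pairing big1 => [|h _]; last first.
    by rewrite ffunE mulr0.
  rewrite -/(pairing y (laplacian (basis g))) /laplacian linearD linearZ => pairing0.
  rewrite [RHS]pairing0; congr (_ + _).
  have -> : cut p n (basis g) = cut_lf g by exact/extend_basis/cut_invariant.
  by rewrite -sum_add_edge_preimage (linear_sum (graft p n)) (linear_sum (pairing y)).
have sum0 : \sum_g c * Y g ^+ 2 + \sum_k Z k ^+ 2 = 0.
  rewrite (eq_bigr (fun k => \sum_u Y (add_edge k u) * Z k)) => [|k _]; last first.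
    by rewrite {1}expr2 {1}ZE mulr_suml.
  rewrite pair_bigA (partition_big (fun ku => add_edge ku.1 ku.2) predT) //=.
  rewrite -big_split big1 //= => g _.
  rewrite (eq_bigr (fun ku => Y g * Z ku.1)) => [|ku /eqP-> //].
  by rewrite -mulr_sumr expr2 mulrCA -mulrDr Yeq mulr0.
have Y0 g : Y g = 0.
  apply/eqP; rewrite -sqrf_eq0.
  have sq_ge0 (z : R) : 0 <= z ^+ 2 by exact: sqr_ge0.
  move/eqP: sum0; rewrite paddr_eq0 ?sumr_ge0 //; last first.
    by move=> g' _; rewrite mulr_ge0 ?sq_ge0 // ltW.
  move=> /andP[/eqP/psumr_eq0P/(_ g isT) + _].
  have -> : (Y g ^+ 2 == 0) = (c * Y g ^+ 2 == 0).
    by rewrite [RHS]mulf_eq0 (gt_eqF c_gt0).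
  by move=> ->// g' _; rewrite mulr_ge0 ?sq_ge0 // ltW.
by apply/ffunP => h; rewrite ffunE -[h]reprK -pairing_basis; exact: Y0.
Qed.

(** In finite dimension the injective transpose is onto, so a vector in the
    kernel pairs to zero with everything. *)
Lemma laplacian_inj x : laplacian x = 0 -> x = 0.
Proof.
move=> x0; have tr_full : limg (linfun laplacian_tr) = fullv.
  apply: lker0_limgf; rewrite -subv0; apply/subvP=> y.
  by rewrite memv_ker memv0 lfunE => /eqP/laplacian_tr_inj->.
apply/ffunP=> h; rewrite ffunE.
have /memv_imgP[y _ yE] : [ffun h' => (h' == h)%:R] \in limg (linfun laplacian_tr).
  by rewrite tr_full memvf.
have := pairing_laplacian x y; rewrite x0 linear0 -[laplacian_tr y]lfunE -yE.
rewrite /pairing (bigD1 h) //= ffunE eqxx mulr1 big1 ?addr0 // => h' /negPf hh'.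
by rewrite ffunE hh' mulr0.
Qed.

End Laplacian.

(** * Exactness of the rows and of the columns *)

Lemma dHE n p x : dH R N n p x = graft p n x.
Proof. by rewrite lfunE. Qed.

Lemma graft_Omega n p x : x \in Omega R N n.+1 p -> graft p n x \in Omega R N n p.
Proof.
rewrite !mem_Omega => -[x_roots x_covs]; split.
  exact: (alternating_down (@graft_act p) x_roots).
exact: (equivariant_alternating (V := fun p => Span n.+1 p) (W := fun p => Span n p)
  (@graft_covs p n) x_covs).
Qed.

Lemma alternate_cut_Omega n p x :
  x \in Omega R N n p -> alternate (act_roots p) (cut p n x) \in Omega R N n.+1 p.
Proof.
rewrite !mem_Omega => -[x_roots x_covs]; split.
  exact: (alternating_alternate (@act_roots_mul p)).
move=> t; rewrite (equivariant_alternate (V := fun n => Span n p) (W := fun n => Span n p)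
  (B := act_roots p) (f := act_covs n.+1 t)) => [|s z]; last exact/esym/act_roots_covs.
by rewrite -cut_covs x_covs linearZ /= alternateZ.
Qed.

Lemma dH_image_sub_ker n p :
  (dH R N n.+1 p @: Omega R N n.+2 p <= lker (dH R N n p) :&: Omega R N n.+1 p)%VS.
Proof.
apply/subvP=> _ /memv_imgP[x x_Omega ->].
rewrite memv_cap memv_ker !dHE graft_Omega // andbT.
have [x_roots _] := (mem_Omega x).1 x_Omega.
by rewrite (down_down (V := fun n => Span n p) (@graft_graft p n) x_roots).
Qed.

(** On the space Z of closed forms the Laplacian P is d_H of a form, so P maps Z
    into the image of d_H, itself contained in Z. As P is injective, its image
    of Z is all of Z. *)
Lemma dH_exact n p : (0 < N)%N ->
  (dH R N n.+1 p @: Omega R N n.+2 p)%VS = (lker (dH R N n p) :&: Omega R N n.+1 p)%VS.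
Proof.
move=> N_gt0; apply/eqP; rewrite eqEsubv dH_image_sub_ker /=.
set Z := (_ :&: _)%VS; pose c : R := N%:R * n.+1%:R.
have c_gt0 : 0 < c by rewrite mulr_gt0 // ltr0n.
pose P := linfun (@laplacian n.+1 p c).
have PZ : (P @: Z <= dH R N n.+1 p @: Omega R N n.+2 p)%VS.
  apply/subvP=> _ /memv_imgP[x /memv_capP[x_ker x_Omega] ->].
  have [x_roots _] := (mem_Omega x).1 x_Omega.
  rewrite memv_ker dHE in x_ker.
  have := homotopy (V := fun n => Span n p) (@act_roots_mul p) (@cut_act p) (@graft_act p)
    (@cut_graft p) x_roots.
  rewrite (eqP x_ker) linear0 alternate0 scaler0 addr0 => homotopy_x.
  have -> : P x = n.+2%:R *: graft p n.+1 (alternate (act_roots p) (cut p n.+1 x)).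
    by rewrite lfunE homotopy_x.
  rewrite -dHE -linearZ memv_img // memvZ //; exact: alternate_cut_Omega.
suff <- : (P @: Z)%VS = Z by [].
apply/eqP; rewrite eqEdim (subv_trans PZ (dH_image_sub_ker n p)) limg_dim_eq ?leqnn //.
apply/eqP; rewrite -subv0; apply/subvP=> x; rewrite memv_cap memv_ker memv0 lfunE.
by move=> /andP[_ /eqP/(laplacian_inj c_gt0)->].
Qed.

Lemma forget_cov_Omega n p x :
  x \in Omega R N n p.+1 -> forget_cov n p x \in Omega R N n p.
Proof.
rewrite !mem_Omega => -[x_roots x_covs]; split.
  exact: (equivariant_alternating (V := fun n => Span n p.+1) (W := fun n => Span n p)
    (@forget_cov_roots n p) x_roots).
exact: (alternating_down (@forget_cov_act n) x_covs).
Qed.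

Lemma alternate_add_cov_Omega n p x :
  x \in Omega R N n p -> alternate (act_covs n) (add_cov n p x) \in Omega R N n p.+1.
Proof.
rewrite !mem_Omega => -[x_roots x_covs]; split; last first.
  exact: (alternating_alternate (@act_covs_mul n)).
move=> t; rewrite (equivariant_alternate (V := fun p => Span n p) (W := fun p => Span n p)
  (B := act_covs n) (f := act_roots p.+1 t)) => [|s z]; last exact: act_roots_covs.
by rewrite -add_cov_roots x_roots linearZ /= alternateZ.
Qed.

Lemma dVE n p x : x \in Omega R N n p ->
  dV R N n p x = alternate (act_covs n) (add_cov n p x).
Proof.
move=> x_Omega; rewrite /dV comp_lfunE wedgeE.
have -> : linfun (extend (@sum_to_cov_lf R N n p)) x = add_cov n p x by rewrite lfunE.
by have /mem_Omega[/alternate_id] := alternate_add_cov_Omega x_Omega.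
Qed.

(** Each of the N nodes contributes x once: the vertices through [down (up x)],
    the covertices through the term k m x of [homotopy]. *)
Lemma forget_dV n p x : x \in Omega R N n p.+1 ->
  p.+2%:R *: forget_cov n p.+1 (dV R N n p.+1 x)
  + p.+1%:R *: dV R N n p (forget_cov n p x) = N%:R *: x.
Proof.
move=> x_Omega; have [_ x_covs] := (mem_Omega x).1 x_Omega.
rewrite !dVE ?forget_cov_Omega //.
rewrite (homotopy (V := fun p => Span n p) (@act_covs_mul n) (@add_cov_act n)
  (@forget_cov_act n) (@add_forget_cov n) x_covs) mul1r.
by rewrite forget_add_cov -scalerDl addrC subrK.
Qed.

Lemma dV_exact n p : (0 < N)%N ->
  (dV R N n p @: Omega R N n p)%VS = (lker (dV R N n p.+1) :&: Omega R N n p.+1)%VS.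
Proof.
move=> N_gt0; apply/eqP; rewrite eqEsubv; apply/andP; split; apply/subvP => x.
  move=> /memv_imgP[y y_Omega ->]; have yO := alternate_add_cov_Omega y_Omega.
  rewrite memv_cap memv_ker (dVE y_Omega) yO andbT dVE //.
  by rewrite (alternate_up_up (V := fun p => Span n p) (@act_covs_mul n) (@add_cov_act n)
    y (@add_add_cov n p)).
move=> /memv_capP[x_ker x_Omega]; have := forget_dV x_Omega.
rewrite memv_ker in x_ker; rewrite (eqP x_ker) linear0 scaler0 add0r.
move/(congr1 ( *:%R N%:R^-1)); rewrite /= [_ *: (N%:R *: x)]scalerA.
rewrite mulVf ?pnatr_eq0 -?lt0n // scale1r => <-.
by rewrite !memvZ // memv_img // forget_cov_Omega.
Qed.

Lemma dV_injective n : (0 < N)%N -> {in Omega R N n 0 &, injective (dV R N n 0)}.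
Proof.
move=> N_gt0 x y xO yO.
have forget z : z \in Omega R N n 0 -> forget_cov n 0 (dV R N n 0 z) = N%:R *: z.
  move=> zO; have [_ z_covs] := (mem_Omega z).1 zO; rewrite dVE //.
  (* There is a single covertex, hence nothing to antisymmetrize. *)
  have := alternate_swaps (V := fun p => Span n p) (@act_covs_mul n) (y := add_cov n 0 z).
  rewrite big_ord0 subr0 scale1r => -> => [|s]; first by rewrite forget_add_cov subr0.
  by rewrite -add_cov_act z_covs linearZ.
move/(congr1 (forget_cov n 0)); rewrite !forget //; apply: scalerI.
by rewrite pnatr_eq0 -lt0n.
Qed.

End Forests.

Theorem theorem2p9 (R : realType) (N : nat) (N_gt0 : (0 < N)%N) :
  (forall n p : nat,
     (dH R N n.+1 p @: Omega R N n.+2 p)%VS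
     = (lker (dH R N n p) :&: Omega R N n.+1 p)%VS) /\
  (forall n p : nat,
     (dV R N n p @: Omega R N n p)%VS
     = (lker (dV R N n p.+1) :&: Omega R N n p.+1)%VS) /\
  (forall n : nat, {in Omega R N n 0 &, injective (dV R N n 0)}).
Proof.
split; first by move=> n p; exact: dH_exact.
by split=> [n p|n]; [exact: dV_exact|exact: dV_injective].
Qed.
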